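(* Let $T:V\to A$ be a relative Rota-Baxter operator on a left pre-Jacobi-Jordan algebra $(A,\cdot)$ with respect to a representation $(V;\rho,\mu)$. Define $$u\cdot_T v=\rho(Tu)v+\mu(Tv)u,\quad \forall u,v\in V.$$ Then $(V,\cdot_T)$ is a left pre-Jacobi-Jordan algebra.
   Context: All vector spaces are finite dimensional over a field $\mathbb{K}$ of characteristic $0$; an algebra is a vector space with a bilinear product, not assumed associative. A left pre-Jacobi-Jordan algebra is an algebra $(A,\cdot)$ whose anti-associator $Aasso(x,y,z):=(x\cdot y)\cdot z+x\cdot(y\cdot z)$ satisfies $Aasso(x,y,z)=-Aasso(y,x,z)$ for all $x,y,z\in A$. A representation $(V;\rho,\mu)$ of $(A,\cdot)$ is a vector space $V$ with linear maps $\rho,\mu:A\to gl(V)$ such that for all $x,y\in A$ $$\rho(x\cdot y+y\cdot x)=-\rho(x)\rho(y)-\rho(y)\rho(x),\qquad \mu(y)\mu(x)+\mu(x\cdot y)=-\mu(y)\rho(x)-\rho(x)\mu(y).$$ A linear map $T:V\to A$ is a relative Rota-Baxter operator on $(A,\cdot)$ with respect to $(V;\rho,\mu)$ if $T(u)\cdot T(v)=T(\rho(Tu)v+\mu(Tv)u)$ for all $u,v\in V$. *)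

(* Defs.v *)
From mathcomp Require Import all_boot all_algebra.

Set Implicit Arguments.
Unset Strict Implicit.
Unset Printing Implicit Defensive.

Import GRing.Theory.
Local Open Scope ring_scope.

Definition anti_associator (K : fieldType) (A : vectType K)
    (mul : A -> A -> A) (x y z : A) : A :=
  mul (mul x y) z + mul x (mul y z).

(* Products are plain functions, so bilinearity is part of the predicate: as a
   conclusion it also asserts that the product is that of an algebra. *)
Definition left_pre_Jacobi_Jordan (K : fieldType) (A : vectType K)
    (mul : A -> A -> A) : Prop :=
  bilinear_for *:%R *:%R mul /\
  forall x y z : A, anti_associator mul x y z = - anti_associator mul y x z.

Definition is_representation (K : fieldType) (A V : vectType K)
    (mul : A -> A -> A) (rho mu : 'Hom(A, 'End(V))) : Prop :=
  forall x y : A,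
    rho (mul x y + mul y x) = - (rho x \o rho y)%VF - (rho y \o rho x)%VF /\
    (mu y \o mu x)%VF + mu (mul x y) =
      - (mu y \o rho x)%VF - (rho x \o mu y)%VF.

Definition rb_product (K : fieldType) (A V : vectType K)
    (rho mu : 'Hom(A, 'End(V))) (T : 'Hom(V, A)) (u v : V) : V :=
  rho (T u) v + mu (T v) u.

Definition is_relative_Rota_Baxter (K : fieldType) (A V : vectType K)
    (mul : A -> A -> A) (rho mu : 'Hom(A, 'End(V))) (T : 'Hom(V, A)) : Prop :=
  forall u v : V, mul (T u) (T v) = T (rho (T u) v + mu (T v) u).

(* Main.v *)
Require Import Defs.
From mathcomp Require Import all_boot all_algebra.
Import GRing.Theory.
Local Open Scope ring_scope.

(** Since [T] carries the new product to [mul], the anti-associator of [u, v, w] expands into six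
    terms, two acting on each vector. Adding the same expansion with [u] and [v] swapped, the terms
    on [w] cancel by the [rho]-axiom at [T u, T v], and those on [v] and on [u] by the [mu]-axiom at
    [T u, T w] and at [T v, T w]. *)

Lemma rb_product_bilinear (K : fieldType) (A V : vectType K)
    (rho mu : 'Hom(A, 'End(V))) (T : 'Hom(V, A)) :
  bilinear_for *:%R *:%R (rb_product rho mu T).
Proof.
split=> w a u v; rewrite /rb_product !linearP /= !add_lfunE !scale_lfunE.
  by rewrite scalerDr addrACA.
by rewrite scalerDr addrACA.
Qed.

(** The axiom is evaluated at a vector with all terms on one side, so that a matching group of four
    terms rewrites to zero. *)
Lemma representation_rhoE (K : fieldType) (A V : vectType K)
    (mul : A -> A -> A) (rho mu : 'Hom(A, 'End(V))) (x y : A) (w : V) :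
  is_representation mul rho mu ->
  rho (mul x y) w + rho (mul y x) w + (rho x (rho y w) + rho y (rho x w)) = 0.
Proof.
move=> /(_ x y)[/lfunP/(_ w) + _].
rewrite linearD !lfunE /= !lfunE /= !lfunE /= => ->.
by rewrite -opprD addNr.
Qed.

Lemma representation_muE (K : fieldType) (A V : vectType K)
    (mul : A -> A -> A) (rho mu : 'Hom(A, 'End(V))) (x y : A) (v : V) :
  is_representation mul rho mu ->
  mu y (mu x v) + mu (mul x y) v + (mu y (rho x v) + rho x (mu y v)) = 0.
Proof.
move=> /(_ x y)[_ /lfunP/(_ v)].
rewrite !lfunE /= !lfunE /= !lfunE /= => ->.
by rewrite -opprD addNr.
Qed.

Lemma rb_product_anti_associator (K : fieldType) (A V : vectType K)
    (mul : A -> A -> A) (rho mu : 'Hom(A, 'End(V))) (T : 'Hom(V, A))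
    (u v w : V) :
  is_relative_Rota_Baxter mul rho mu T ->
  anti_associator (rb_product rho mu T) u v w =
    rho (mul (T u) (T v)) w + rho (T u) (rho (T v) w)
    + (mu (T w) (rho (T u) v) + rho (T u) (mu (T w) v))
    + (mu (T w) (mu (T v) u) + mu (mul (T v) (T w)) u).
Proof.
(* Used backwards, [hT] turns [T] of a product into a [mul] of images before linearity splits the
   outer actions. *)
move=> hT; rewrite /anti_associator /rb_product -!hT !linearD /=.
(* Terms are paired by the vector acted on: [w], [v], [u]. *)
by rewrite (AC ((1*2)*(2*1)) ((1*4)*(2*5)*(3*6))).
Qed.

Theorem proposition4p12 (K : fieldType) (charK0 : [pchar K] =i pred0)
    (A V : vectType K) (mul : A -> A -> A) (rho mu : 'Hom(A, 'End(V)))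
    (T : 'Hom(V, A))
    (hA : left_pre_Jacobi_Jordan mul)
    (hV : is_representation mul rho mu)
    (hT : is_relative_Rota_Baxter mul rho mu T) :
  left_pre_Jacobi_Jordan (rb_product rho mu T).
Proof.
split=> [|u v w]; first exact: rb_product_bilinear.
apply/eqP; rewrite -addr_eq0.
rewrite !(rb_product_anti_associator _ _ _ _ _ _ _ _ _ _ hT).
(* Grouped by the vector acted on ([w], then [v], then [u]), the twelve terms
   form one instance of the rho-axiom and two of the mu-axiom. *)
rewrite (AC ((2*2*2)*(2*2*2))
  (((1*7)*(2*8))*((11*12)*(3*4))*((5*6)*(9*10)))) /=.
by rewrite (representation_rhoE _ _ _ _ _ _ _ _ _ hV)
           !(representation_muE _ _ _ _ _ _ _ _ _ hV) !addr0.
Qed.
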